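(* Let $Y = (Y_t)_{t=0,1,2,\dots}$ be an irreducible discrete-time upward skip-free Markov chain on the nonnegative integers with $Y_0 = 0$. Given $d$, let $X$ (with state space $\{0,\dots,d\}$) be the chain obtained from $Y$ by making $d$ an absorbing state, and let $P$ denote the transition matrix of $X$. Let $T$ be the hitting time of state $d$ (the same for $X$ and $Y$). Then $T$ has probability generating function $$ u \mapsto \mathbf{E}\,u^T = \prod_{j=0}^{d-1} \left[ \frac{(1-\theta_j)u}{1-\theta_j u} \right], $$ where $\theta_0,\dots,\theta_{d-1}$ are the $d$ non-unit eigenvalues of $P$. In particular, if every $\theta_j$ is real and nonnegative, then the distribution of $T$ is the convolution of the Geometric$(1-\theta_j)$ distributions, $j=0,\dots,d-1$.
   Context: A discrete-time Markov chain on the nonnegative integers with transition probabilities $p_{ij}$ is (upward) skip-free if $p_{ij}=0$ whenever $j > i+1$ (upward jumps are only of unit size; downward jumps are unrestricted). ''Making $d$ absorbing'' means that $P$ is the matrix indexed by $\{0,\dots,d\}$ whose rows $i<d$ agree with those of $Y$ and whose row $d$ is the unit mass at $d$. Eigenvalues are complex and listed with algebraic multiplicity. Probability generating functions are considered for $|u|<1$. Geometric$(p)$ denotes the distribution on $\{1,2,\dots\}$ with $\Pr(k) = p(1-p)^{k-1}$. *)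

(* Defs.v *)
From HB Require Import structures.
From mathcomp Require Import all_boot all_order all_algebra.
From mathcomp Require Import all_classical all_reals all_analysis.
From mathcomp Require Import complex.

Set Implicit Arguments.
Unset Strict Implicit.
Unset Printing Implicit Defensive.

Import Order.TTheory GRing.Theory Num.Theory.
Import numFieldNormedType.Exports.

Local Open Scope classical_set_scope.
Local Open Scope ring_scope.

Section TransitionKernels.
Context {R : realType}.
Implicit Types p q : nat -> nat -> R.

Definition stochastic p :=
  (forall i j, 0 <= p i j) /\
  (forall i, (\sum_(0 <= j <oo) (p i j)%:E)%E = 1%E).

Definition skip_free p := forall i j, (i.+1 < j)%N -> p i j = 0.

Fixpoint nstep p (n : nat) (i j : nat) : \bar R :=
  if n is m.+1 then (\sum_(0 <= k <oo) (p i k)%:E * nstep p m k j)%E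
  else ((i == j)%:R)%:E.

Definition irreducible p := forall i j, exists n, (0 < nstep p n i j)%E.

Definition absorbing_kernel (d : nat) p : nat -> nat -> R :=
  fun i j => if i == d then (j == d)%:R else p i j.

Definition absorbing_matrix (d : nat) p : 'M[R]_d.+1 :=
  \matrix_(i, j) absorbing_kernel d p i j.

End TransitionKernels.

Section Processes.
Context {disp : measure_display} {Omega : measurableType disp} {R : realType}.
Variable Pr : probability Omega R.

(* Time-homogeneous Markov property, conditionally on the whole past. *)
Definition markov_chain (q : nat -> nat -> R) (Z : nat -> Omega -> nat) :=
  (forall n, measurable_fun setT (Z n)) /\
  forall (n : nat) (x : nat -> nat) (j : nat),
    let past := [set w | forall s, (s <= n)%N -> Z s w = x s] in
    let next := [set w | Z n.+1 w = j] in
    Pr past != 0%E ->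
    fine (Pr (past `&` next)) / fine (Pr past) = q (x n) j.

(* [None] stands for an infinite hitting time. *)
Definition hitting_time (d : nat) (Z : nat -> Omega -> nat) (w : Omega)
    : option nat :=
  if pselect (exists t, Z t w == d) is left hits then Some (ex_minn hits)
  else None.

(* The process Z stopped at the time it hits d. *)
Definition absorbed (d : nat) (Z : nat -> Omega -> nat) : nat -> Omega -> nat :=
  fun t w => if hitting_time d Z w is Some s then Z (minn t s) w else Z t w.

Definition cexpectation (Z : Omega -> R[i]) : R[i] :=
  Complex (fine 'E_Pr[fun w => complex.Re (Z w)])
          (fine 'E_Pr[fun w => complex.Im (Z w)]).

(* For |u| < 1 the convention is u ^ oo = 0, whereas u ^ 0 = 1 even if u = 0. *)
Definition pgf (T : Omega -> option nat) (u : R[i]) : R[i] :=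
  cexpectation (fun w => if T w is Some n then u ^+ n else 0).

(* T is almost surely finite with probability mass function f. *)
Definition has_distribution (T : Omega -> option nat) (f : nat -> R) :=
  Pr [set w | T w = None] = 0%E /\
  forall k, Pr [set w | T w = Some k] = (f k)%:E.

End Processes.

Section Distributions.
Context {R : realType}.

Definition geometric_pmf (r : R) (k : nat) : R :=
  if k is m.+1 then r * (1 - r) ^+ m else 0.

Definition dirac0_pmf (k : nat) : R := (k == 0)%N%:R.

Definition convolution (f g : nat -> R) (k : nat) : R :=
  \sum_(i < k.+1) f i * g (k - i)%N.

End Distributions.

(* s lists the complex eigenvalues of A with algebraic multiplicity. *)
Definition spectrum {R : realType} {n : nat} (A : 'M[R]_n) (s : seq R[i]) :=
  char_poly (map_mx (real_complex R) A) = \prod_(z <- s) ('X - z%:P).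

Lemma spectrum_exists {R : realType} {n : nat} (A : 'M[R]_n) :
  exists s, spectrum A s.
Proof.
have [s sE] := closed_field_poly_normal (char_poly (map_mx (real_complex R) A)).
exists s; rewrite /spectrum {1}sE.
by rewrite (monicP (char_poly_monic _)) scale1r.
Qed.

(* Main.v *)
Require Import Defs.
From mathcomp Require Import all_boot all_order all_algebra.
From mathcomp Require Import all_classical all_reals all_analysis.
From mathcomp Require Import measurable_realfun complex ring.

Import Order.TTheory GRing.Theory Num.Theory.
Import numFieldNormedType.Exports.
Local Open Scope classical_set_scope.
Local Open Scope ring_scope.

(** Let [a n = Pr (X_n = d)], which is the entry [(0, d)] of [P ^+ n], so that
    [a n = Pr (T <= n)].  Upward steps have size one, hence [a n = 0] for
    [n < d], and [a d] is the product [c] of the entries [p i i.+1], [i < d].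
    By Cayley-Hamilton, [a] obeys from index [d.+1] on the linear recurrence
    whose characteristic polynomial is that of [P].  Said with generating
    functions: multiplying [\sum_n a n u ^ n] by the product of [1 - z u] over
    all the eigenvalues [z] of [P] leaves the single monomial [c u ^ d]
    ([absorbing_recurrence]).  The factor [1 - u] of the eigenvalue 1 replaces
    [a] by its differences, that is, by the probability mass function of [T];
    what remains is [(\prod_theta (1 - theta u)) E u^T = c u ^ d]
    ([hitting_pgf]).

    It remains to see that 1 is a simple eigenvalue and that
    [c = \prod_theta (1 - theta)] ([absorbing_char_poly]).  Factor the
    characteristic polynomial as [('X - 1) * D].  Then [D(P) P = D(P)], so the
    row 0 of [D(P)] is invariant under [P]; since irreducibility forces
    [p i i.+1 > 0], such a row vanishes off [d] ([absorbing_invariant]).  Its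
    entry at [d] is [c], because [D] is monic of degree [d].  Applying [D(P)]
    to the vector of ones, which [P] fixes, gives [D(1) = c], and [c != 0].

    The identity for the generating function holds on the closed unit disk; at
    [u = 1] it says that [T] is almost surely finite.  When the [theta]s are
    nonnegative reals, the convolution of the geometric laws solves the same
    recurrence as the law of [T], and the recurrence has only one solution. *)

(** * Sequences multiplied by linear factors *)

(** On generating functions this is the multiplication by [1 - z u]. *)
Definition shift_diff {K : pzRingType} (z : K) (f : nat -> K) (n : nat) : K :=
  f n - z * (if n is m.+1 then f m else 0).

Lemma eq_shift_diff {K : pzRingType} (z : K) (f g : nat -> K) :
  f =1 g -> shift_diff z f =1 shift_diff z g.
Proof. by move=> fg [|n]; rewrite /shift_diff !fg. Qed.

(** The factors have constant term 1, so they keep the lowest term of a series. *)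
Lemma foldr_shift_diff_low {K : pzRingType} (f : nat -> K) (d : nat) s :
  (forall n, (n < d)%N -> f n = 0) ->
  (forall n, (n < d)%N -> foldr shift_diff f s n = 0) /\
  foldr shift_diff f s d = f d.
Proof.
move=> f0; elim: s => [//|z s [IH1 IH2]] /=; split=> [[|n] nd|].
- by rewrite /shift_diff mulr0 subr0 IH1.
- by rewrite /shift_diff !IH1 ?mulr0 ?subr0 // ltnW.
- by case: d f0 IH1 IH2 => [|d] f0 IH1 IH2; rewrite /shift_diff IH2 ?IH1 ?mulr0 ?subr0.
Qed.

Lemma foldr_shift_diff_rmorph {K L : pzRingType} (h : {rmorphism K -> L})
    (f : nat -> K) s n :
  foldr shift_diff (fun m => h (f m)) [seq h z | z <- s] n =
  h (foldr shift_diff f s n).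
Proof.
elim: s n => [//|z s IH] n /=.
rewrite /shift_diff IH rmorphB rmorphM /=; congr (_ - _ * _).
by case: n => [|n]; rewrite ?IH ?rmorph0.
Qed.

(** * Powers of a Hessenberg matrix with an absorbing index *)

(** On the entries of [A ^+ n], multiplying the generating function by
    [1 - z u] amounts to multiplying the matrix by [A - z]. *)
Lemma foldr_shift_diff_mx {K : comNzRingType} {d : nat} (A : 'M[K]_d.+1) (i j : 'I_d.+1) s n :
  foldr shift_diff (fun m => (A ^+ m) i j) s (size s + n)%N =
  (horner_mx A (\prod_(z <- s) ('X - z%:P)) * A ^+ n) i j.
Proof.
elim: s n => [|z s IH] n; first by rewrite big_nil rmorph1 mul1r.
rewrite /= /shift_diff addSn -addnS !IH big_cons rmorphM rmorphB /=.
rewrite horner_mx_X horner_mx_C -mulrA mulrBl exprS.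
set H := horner_mx A _.
have -> : H * (A * A ^+ n) = A * (H * A ^+ n).
  rewrite !mulrA; congr (_ * _); exact/comm_horner_mx.
by rewrite -[z%:M * _]/(z%:M *m _) mul_scalar_mx !mxE.
Qed.

Definition hessenberg {K : pzRingType} {n : nat} (A : 'M[K]_n) :=
  forall i j : 'I_n, (i.+1 < j)%N -> A i j = 0.

Lemma horner_mx_sum {K : comNzRingType} {d : nat} (A : 'M[K]_d.+1) (q : {poly K}) :
  horner_mx A q = \sum_(i < size q) q`_i *: A ^+ i.
Proof.
rewrite -[q in LHS]coefK poly_def linear_sum; apply: eq_bigr => i _.
by rewrite linearZ /= rmorphXn /= horner_mx_X.
Qed.

Section Hessenberg.
Context {K : fieldType} {d : nat} (A : 'M[K]_d.+1).
Hypothesis hA : hessenberg A.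

Let superdiag := \prod_(i < d) A (inord i) (inord i.+1).

(** Climbing from 0 to [j] takes at least [j] unit steps, and exactly [j] only
    along the superdiagonal. *)
Lemma hessenberg_expr n (j : 'I_d.+1) :
  ((n < j)%N -> (A ^+ n) ord0 j = 0) /\
  (n = j -> (A ^+ n) ord0 j = \prod_(i < n) A (inord i) (inord i.+1)).
Proof.
elim: n j => [|n IH] j.
  split=> [j0|j0]; first by rewrite expr0 mxE; case: eqP j0 => // <-.
  rewrite big_ord0 expr0 mxE; case: eqP => // /eqP; rewrite -val_eqE /=.
  by rewrite -j0.
rewrite exprSr; split=> nj; rewrite -[_ * A]/(_ *m A) mxE.
  apply: big1 => k _; have [nk|kn] := ltnP n k.
    by rewrite (IH k).1 ?mul0r.
  by rewrite hA ?mulr0 // (leq_ltn_trans _ nj).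
have nd : (n < d.+1)%N by rewrite ltnW // nj.
rewrite (bigD1 (inord n)) //= big1 ?addr0; last first.
  move=> k; rewrite -val_eqE /= inordK // neq_ltn => /orP[kn|nk].
    by rewrite hA ?mulr0 // -nj ltnS.
  by rewrite (IH k).1 ?mul0r.
rewrite (IH _).2 ?inordK // big_ord_recr /=; congr (_ * A _ _).
by apply: val_inj; rewrite /= inordK // nj.
Qed.

(** Only the leading term of [q] is of high enough degree to reach the last index. *)
Lemma hessenberg_horner (q : {poly K}) :
  q \is monic -> size q = d.+1 -> (horner_mx A q) ord0 ord_max = superdiag.
Proof.
move=> qm qs.
rewrite horner_mx_sum qs summxE big_ord_recr /= big1 => [|i _].
  rewrite add0r mxE (hessenberg_expr d ord_max).2 //.
  by have := monicP qm; rewrite lead_coefE qs /= => ->; rewrite mul1r.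
by rewrite mxE (hessenberg_expr i ord_max).1 ?mulr0 /=.
Qed.

Hypothesis superdiag_neq0 : superdiag != 0.
Hypothesis Amax : row ord_max A = delta_mx 0 ord_max.
Hypothesis A1 : A *m const_mx 1 = const_mx 1 :> 'cV_d.+1.

(** Read the columns of [v *m A = v] from the last to the first: each one
    brings a single new unknown, multiplied by a superdiagonal entry. *)
Lemma absorbing_invariant (v : 'rV[K]_d.+1) :
  v *m A = v -> forall j : 'I_d.+1, (j < d)%N -> v 0 j = 0.
Proof.
move=> vA.
have sd0 (i : 'I_d) : A (inord i) (inord i.+1) != 0.
  by move: superdiag_neq0 => /prodf_neq0; apply.
(* Induction on the distance [m] of [j] to the last index. *)
suff H m : forall j : 'I_d.+1, (d <= j + m)%N -> (j < d)%N -> v 0 j = 0.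
  by move=> j jd; apply: (H d j) => //; rewrite leq_addl.
elim: m => [j|m IH j jm jd]; first by rewrite addn0 leqNgt => /negbTE ->.
have := congr1 (fun w : 'rV_d.+1 => w 0 (inord j.+1)) vA.
rewrite mxE (bigD1 j) //=.
have E : v 0 (inord j.+1) = v 0 ord_max * A ord_max (inord j.+1).
  have := congr1 (fun w : 'rV_d.+1 => w 0 (inord j.+1)) Amax.
  rewrite !mxE /= => ->.
  case: eqP => [->|/eqP]; first by rewrite mulr1.
  rewrite -val_eqE /= inordK ?ltnS // => jmax; rewrite mulr0.
  apply: IH; rewrite inordK ?ltnS //; first by rewrite addSnnS.
  by rewrite ltn_neqAle jmax jd.
rewrite (bigD1 ord_max) /=; last by rewrite -val_eqE /= gtn_eqF.
rewrite -E big1 ?addr0 => [|k /andP[kj kmax]].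
  move/eqP; rewrite -subr_eq0 addrK mulf_eq0 => /orP[/eqP //|].
  by have := sd0 (Ordinal jd); rewrite /= inord_val => /negbTE ->.
have kd : (k < d)%N by rewrite ltn_neqAle kmax -ltnS ltn_ord.
have [jk|jk] := ltnP j k.
  by rewrite IH ?mul0r // (leq_trans jm) // -addSnnS leq_add2r.
rewrite hA ?mulr0 // inordK ?ltnS // ltn_neqAle.
by rewrite val_eqE kj.
Qed.

(** The cofactor [D] of ['X - 1] takes the value [superdiag] at 1, hence does not
    vanish there: 1 is a simple eigenvalue. *)
Lemma absorbing_char_poly (s : seq K) :
  char_poly A = \prod_(z <- s) ('X - z%:P) ->
  let theta := [seq z <- s | z != 1] in
  [/\ size theta = d,
      \prod_(z <- theta) (1 - z) = superdiag &
      char_poly A = \prod_(z <- rcons theta 1) ('X - z%:P)].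
Proof.
move=> As theta.
have s1 : 1 \in s.
  rewrite -root_prod_XsubC -As -eigenvalue_root_char.
  apply/eigenvalueP; exists (delta_mx 0 ord_max).
    by rewrite scale1r -rowE Amax.
  apply/eqP => /matrixP/(_ 0 ord_max); rewrite !mxE !eqxx => /eqP.
  by rewrite oner_eq0.
(* [s'] removes a single copy of 1 from [s]; that no copy is left comes last. *)
have ps := perm_to_rem s1; set s' := rem 1 s in ps.
have As' : char_poly A = ('X - 1%:P) * \prod_(z <- s') ('X - z%:P).
  by rewrite As (perm_big _ ps) big_cons.
have ss : size s' = d.
  have := size_char_poly A.
  by rewrite As (perm_big _ ps) size_prod_XsubC => -[].
set D := \prod_(z <- s') ('X - z%:P) in As'.
have Dm : D \is monic by apply: monic_prod_XsubC.
have Ds : size D = d.+1 by rewrite size_prod_XsubC ss.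
have DA : horner_mx A D *m A = horner_mx A D.
  apply/eqP; rewrite -subr_eq0 -[X in _ *m A - X]mulmx1 -mulmxBr; apply/eqP.
  transitivity (horner_mx A (char_poly A)); last exact: Cayley_Hamilton.
  by rewrite As' mulrC rmorphM rmorphB /= horner_mx_X horner_mx_C.
have D1 : horner_mx A D *m const_mx 1 = D.[1] *: const_mx 1 :> 'cV_d.+1.
  rewrite horner_mx_sum horner_coef mulmx_suml scaler_suml.
  apply: eq_bigr => i _; rewrite expr1n mulr1 -scalemxAl; congr (_ *: _).
  elim: (nat_of_ord i) => [|k IH]; first by rewrite expr0 mul1mx.
  by rewrite exprSr -mulmxA A1.
have D1c : D.[1] = superdiag.
  have := congr1 (fun w : 'cV_d.+1 => w ord0 0) D1.
  rewrite !mxE mulr1 => <-.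
  rewrite (bigD1 ord_max) //= big1 ?addr0.
    by rewrite mxE mulr1 hessenberg_horner.
  move=> j; rewrite -val_eqE /= => jd.
  have := @absorbing_invariant (row 0 (horner_mx A D)).
  rewrite -row_mul DA => /(_ erefl j); rewrite mxE => ->; first by rewrite mul0r.
  by rewrite ltn_neqAle jd -ltnS ltn_ord.
have E1 : D.[1] = \prod_(z <- s') (1 - z).
  by rewrite horner_prod; apply: eq_bigr => z _; rewrite hornerXsubC.
have s'1 : 1 \notin s'.
  by rewrite -root_prod_XsubC -/D /root D1c.
have pt : perm_eq theta s'.
  rewrite /theta (perm_trans (perm_filter _ ps)) //= eqxx /=.
  by rewrite (all_filterP _) //; apply/allP => z zs; apply: contraNneq s'1 => <-.
split.
- by rewrite (perm_size pt).
- by rewrite (perm_big _ pt) -E1 D1c.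
- rewrite (perm_big (1 :: theta)) ?perm_rcons //=.
  by rewrite As' big_cons (perm_big _ pt).
Qed.

(** The terms of index above [d] vanish by Cayley-Hamilton, those below [d]
    because [d] steps are needed to climb from 0 to [d]. *)
Lemma absorbing_recurrence (theta : seq K) :
  char_poly A = \prod_(z <- rcons theta 1) ('X - z%:P) -> size theta = d ->
  foldr shift_diff (fun n => (A ^+ n) ord0 ord_max) (rcons theta 1) =1
  fun n => if n == d then superdiag else 0.
Proof.
move=> At st n.
have low m : (m < d)%N -> (A ^+ m) ord0 ord_max = 0.
  by move=> md; apply: (hessenberg_expr m ord_max).1.
have [L1 L2] := @foldr_shift_diff_low _ _ d (rcons theta 1) low.
case: ltngtP => [nd|dn|->]; first by rewrite L1.
  have -> : n = (size (rcons theta 1%R) + (n - d.+1))%N.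
    by rewrite size_rcons st subnKC.
  rewrite foldr_shift_diff_mx.
  by rewrite -At Cayley_Hamilton mul0r mxE.
by rewrite L2 (hessenberg_expr d ord_max).2.
Qed.
End Hessenberg.

(** * Convolutions of geometric laws *)

Lemma big_foldr {T I : Type} (op : T -> T -> T) (idx : T) (F : I -> T) (s : seq I) :
  \big[op/idx]_(z <- s) F z = foldr (fun z => op (F z)) idx s.
Proof. by elim: s => [|z s IH]; rewrite ?big_nil ?big_cons //= IH. Qed.

Section GeometricConvolution.
Context {R : realType}.
Implicit Types (f g : nat -> R) (z : R).

Lemma shift_diff_convr z f g :
  shift_diff z (convolution f g) =1 convolution f (shift_diff z g).
Proof.
move=> [|n]; rewrite /shift_diff /convolution; first by rewrite !big_ord1 !mulr0 !subr0.
rewrite [RHS]big_ord_recr [X in X - _]big_ord_recr /= subnn mulr0 subr0 addrAC.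
congr (_ + _); rewrite mulr_sumr -sumrB; apply: eq_bigr => i _.
by rewrite subSn -1?ltnS ?ltn_ord // mulrBr (mulrCA z).
Qed.

(** The generating function [(1 - z) u / (1 - z u)] of the geometric law loses
    its denominator. *)
Lemma shift_diff_geometric_convolution z f :
  shift_diff z (convolution (geometric_pmf (1 - z)) f) =1
  fun n => if n is m.+1 then (1 - z) * f m else 0.
Proof.
move=> [|n]; rewrite /shift_diff /convolution.
  by rewrite big_ord1 mul0r mulr0 subr0.
rewrite [X in X - _]big_ord_recl mul0r add0r /=.
rewrite [X in X - _]big_ord_recl [X in _ - _ * X]big_ord_recl /= mul0r add0r.
rewrite subn1 /= expr0 mulr1 -addrA mulr_sumr -sumrB big1 ?addr0 // => i _.
rewrite /bump /= !add1n exprS subSS.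
have -> : 1 - (1 - z) = z by ring.
ring.
Qed.

Lemma foldr_shift_diff_convolution f g s :
  foldr shift_diff (convolution f g) s =1 convolution f (foldr shift_diff g s).
Proof.
elim: s => [//|z s IH] n /=.
by rewrite (eq_shift_diff _ _ _ IH) shift_diff_convr.
Qed.

Lemma foldr_shift_diff_geometric s :
  foldr shift_diff (foldr (fun z => convolution (geometric_pmf (1 - z))) dirac0_pmf s) s =1
  fun n => if n == size s then \prod_(z <- s) (1 - z) else 0.
Proof.
elim: s => [|z s IH] n /=; first by rewrite big_nil /dirac0_pmf; case: eqP.
rewrite (eq_shift_diff _ _ _ (foldr_shift_diff_convolution _ _ _)).
rewrite shift_diff_geometric_convolution big_cons; case: n => [//|n].
by rewrite IH eqSS; case: eqP; rewrite ?mulr0.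
Qed.

Lemma shift_diff_inj z f g : shift_diff z f =1 shift_diff z g -> f =1 g.
Proof.
move=> fg n; elim: n => [|n IH].
  by have := fg 0%N; rewrite /shift_diff !mulr0 !subr0.
by have := fg n.+1; rewrite /shift_diff IH => /addIr.
Qed.

Lemma foldr_shift_diff_inj s f g :
  foldr shift_diff f s =1 foldr shift_diff g s -> f =1 g.
Proof. by elim: s => [//|z s IH] /= /shift_diff_inj /IH. Qed.
End GeometricConvolution.

(** * Power series with recurrent coefficients *)

Section PowerSeries.
Context {K : numFieldType}.
Implicit Types (u z F : K) (f : nat -> K).

Lemma cvg_series_shift_diff u z F f :
  series (fun n => f n * u ^+ n) @ \oo --> F ->
  series (fun n => shift_diff z f n * u ^+ n) @ \oo --> (1 - z * u) * F.
Proof.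
move=> fF; rewrite -cvg_shiftS mulrBl mul1r.
have -> : [sequence series (fun n => shift_diff z f n * u ^+ n) n.+1]_n =
    (fun n => series (fun n => f n * u ^+ n) n.+1 -
              z * u * series (fun n => f n * u ^+ n) n).
  apply/funext => n; elim: n => [|n IH] /=.
    rewrite !seriesSr /series /= !big_geq // /shift_diff; ring.
  rewrite [LHS]seriesSr [series _ n.+1]IH !seriesSr /shift_diff exprS; ring.
apply: cvgB; first by rewrite (cvg_shiftS (series (fun n => f n * u ^+ n))).
exact: cvgMl_tmp.
Qed.

Lemma cvg_series_foldr_shift_diff u F f s :
  series (fun n => f n * u ^+ n) @ \oo --> F ->
  series (fun n => foldr shift_diff f s n * u ^+ n) @ \oo -->
  (\prod_(z <- s) (1 - z * u)) * F.
Proof.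
move=> fF; elim: s => [|z s IH]; first by rewrite big_nil mul1r.
by rewrite big_cons -mulrA; exact: cvg_series_shift_diff.
Qed.

Lemma cvg_series_monomial u c (d : nat) :
  series (fun n => (if n == d then c else 0) * u ^+ n) @ \oo --> c * u ^+ d.
Proof.
apply: cvg_near_cst; exists d.+1 => // n /= dn.
rewrite /series /= big_mkord (bigD1 (Ordinal dn)) //= eqxx big1 ?addr0 // => i.
by rewrite -val_eqE /= => /negbTE ->; rewrite mul0r.
Qed.

(** A recurrence for the coefficients turns into a closed form for the sum,
    at every point [u] where the series converges. *)
Lemma series_limit_eq u c F f s (d : nat) :
  series (fun n => f n * u ^+ n) @ \oo --> F ->
  foldr shift_diff f s =1 (fun n => if n == d then c else 0) ->
  (\prod_(z <- s) (1 - z * u)) * F = c * u ^+ d.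
Proof.
move=> fF /funext fs; have := cvg_series_foldr_shift_diff _ _ _ s fF.
rewrite fs => H; exact: (cvg_unique _ H (cvg_series_monomial _ _ _)).
Qed.
End PowerSeries.

Lemma cvg_complex {R : realType} (x y : nat -> R) (a b : R) :
  x @ \oo --> a -> y @ \oo --> b ->
  (fun n => Complex (x n) (y n) : (R[i] : numFieldType)) @ \oo -->
  (Complex a b : (R[i] : numFieldType)).
Proof.
move=> xa yb.
have E (p q : R) : Complex p q = p%:C%C + q%:C%C * 'i%C :> R[i].
  by apply/eqP; rewrite eq_complex /= !(mul0r, mulr0, mulr1, subr0, addr0, add0r, subrr) !eqxx.
have C (t : nat -> R) (c : R) : t @ \oo --> c ->
  (fun n => (t n)%:C%C : (R[i] : numFieldType)) @ \oo --> (c%:C%C : (R[i] : numFieldType)).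
  move=> /cvgrPdist_lt tc; apply/cvgrPdist_lt => e e0.
  have [e1 e2] : 0 < complex.Re e /\ e = (complex.Re e)%:C%C.
    move: e0; case: (e) => p q /=; rewrite ltcE /= => /andP[/eqP -> ->]; split=> //.
  have := tc _ e1; apply: filterS => n /=; rewrite {2}e2 => tn.
  by rewrite -rmorphB /= normc_def /= expr0n /= addr0 sqrtr_sqr ltcR.
have -> : (fun n => Complex (x n) (y n)) = (fun n => (x n)%:C%C + (y n)%:C%C * 'i%C).
  by apply/funext => n; rewrite E.
rewrite E; apply: cvgD; first exact: C.
by apply: cvgMr_tmp; exact: C.
Qed.

(** * Expectations over an extended time *)

Section ExtendedTime.
Context {disp : measure_display} {Omega : measurableType disp} {R : realType}.
Variables (Pr : probability Omega R) (T : Omega -> option nat).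
Hypothesis mT : forall k, measurable [set w | T w = Some k].

(** Dominated convergence along the truncations of [T]. *)
Lemma expectation_option (phi : nat -> R) (M : R) :
  (forall k, `|phi k| <= M) ->
  series (fun k => fine (Pr [set w | T w = Some k]) * phi k) @ \oo -->
  fine 'E_Pr[fun w => if T w is Some k then phi k else 0].
Proof.
move=> phiM.
set g := fun w => if T w is Some k then phi k else 0.
(* [h n] is the variable [g] cut off at the times below [n]. *)
pose A k := [set w | T w = Some k].
pose h n w := \sum_(k < n) phi k * \1_(A k) w.
have hE n w : h n w = if T w is Some k then (if (k < n)%N then phi k else 0) else 0.
  rewrite /h; case E : (T w) => [k|]; last first.
    by apply: big1 => k _; rewrite indicE memNset ?mulr0 // /A /= E.
  case: ifP => [kn|kn].
    rewrite (bigD1 (Ordinal kn)) //= indicE mem_set ?mulr1 //.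
    rewrite big1 ?addr0 // => i; rewrite -val_eqE /= => ik.
    by rewrite indicE memNset ?mulr0 // /A /= E => -[/eqP]; rewrite eq_sym (negbTE ik).
  apply: big1 => i _; rewrite indicE memNset ?mulr0 // /A /= E => -[ki].
  by move: kn; rewrite ki ltn_ord.
have M0 : 0 <= M by apply: le_trans (phiM 0%N).
have mh n : measurable_fun setT (h n).
  apply: measurable_sum => k; apply: measurable_funM; first exact: measurable_cst.
  by apply: measurable_indic; exact: mT.
have hg w : h n w @[n --> \oo] --> g w.
  apply: cvg_near_cst; rewrite /g; case E : (T w) => [k|].
    by exists k.+1 => // n /= kn; rewrite hE E kn.
  by exists 0%N => // n _; rewrite hE E.
have mg : measurable_fun setT g.
  by apply: (@measurable_fun_cvg _ _ _ _ h) => // w _.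
have [Ig _ Ih] : [/\ Pr.-integrable setT (EFin \o g),
    [sequence (\int[Pr]_w `|(EFin \o h n) w - (EFin \o g) w|)%E]_n @ \oo --> 0%E &
    [sequence (\int[Pr]_w (EFin \o h n) w)%E]_n @ \oo --> (\int[Pr]_w (EFin \o g) w)%E].
  apply: (@dominated_convergence _ _ _ Pr setT measurableT
    (fun n => EFin \o h n) (EFin \o g) (EFin \o cst M)).
  - by move=> n; apply/measurable_EFinP.
  - exact/measurable_EFinP.
  - by apply: aeW => w _; apply: cvg_EFin; [exact: nearW|exact: hg].
  - exact: finite_measure_integrable_cst.
  - apply: aeW => w n _; rewrite /= lee_fin hE.
    by case: (T w) => [k|]; [case: ifP => _|]; rewrite ?normr0.
have Ehn n : (\int[Pr]_w (EFin \o h n) w)%E =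
    (series (fun k => fine (Pr [set w | T w = Some k]) * phi k) n)%:E.
  rewrite /series /= big_mkord -sumEFin.
  under eq_integral do rewrite /= /h -sumEFin.
  rewrite integral_sum //; last first.
    move=> k; under eq_fun do rewrite EFinM.
    by apply: integrableZl => //; apply: integrable_indic; exact: mT.
  apply: eq_bigr => k _; under eq_integral do rewrite EFinM.
  rewrite integralZl //; last by apply: integrable_indic; exact: mT.
  by rewrite integral_indic ?setIT ?EFinM ?fineK ?fin_num_measure //;
    [rewrite muleC|exact: mT].
have If : (\int[Pr]_w (EFin \o g) w)%E \is a fin_num by exact: integrable_fin_num.
rewrite unlock -/g.
rewrite -(fineK If) in Ih.
have -> : series (fun k => fine (Pr [set w | T w = Some k]) * phi k) =
    fine \o [sequence (\int[Pr]_w (EFin \o h n) w)%E]_n.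
  by apply/funext => n; rewrite /= Ehn.
exact: fine_cvg Ih.
Qed.

(** The unit circle is included: [u = 1] is what yields the almost sure
    finiteness of [T]. *)
Lemma cvg_series_pgf (u : R[i]) : `|u| <= 1 ->
  series (fun k => (fine (Pr [set w | T w = Some k]))%:C%C * u ^+ k
     : (R[i] : numFieldType)) @ \oo --> (pgf Pr T u : (R[i] : numFieldType)).
Proof.
move=> u1.
have uk k : `|u ^+ k| <= 1 by rewrite normrX exprn_ile1.
have re k : `|complex.Re (u ^+ k)| <= 1.
  have := le_trans (normc_ge_Re _) (uk k); by rewrite (lecR _ 1).
have im k : `|complex.Im (u ^+ k)| <= 1.
  have i1 : `|'i%C : R[i]| = 1.
    by rewrite normc_def /= expr0n expr1n add0r sqrtr1.
  have uki : `|u ^+ k * 'i%C| <= 1 by rewrite normrM i1 mulr1.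
  have := le_trans (normc_ge_Re _) uki.
  by rewrite ReiNIm normrN (lecR _ 1).
have := cvg_complex _ _ _ _ (expectation_option _ _ re) (expectation_option _ _ im).
rewrite /pgf /cexpectation.
have -> : (fun w => complex.Re (match T w with Some n => u ^+ n | None => 0 end)) =
  (fun w => match T w with Some n => complex.Re (u ^+ n) | None => 0 end).
  by apply/funext => w; case: (T w).
have -> : (fun w => complex.Im (match T w with Some n => u ^+ n | None => 0 end)) =
  (fun w => match T w with Some n => complex.Im (u ^+ n) | None => 0 end).
  by apply/funext => w; case: (T w).
set F := (fun n => Complex _ _); set G := series _.
suff -> : G = F by [].
apply/funext; elim=> [|n IH]; first by rewrite /F /G /series /= !big_geq.
rewrite /F /G !seriesSr [series _ n]IH /F.
by case: (u ^+ n) => p q; apply/eqP; rewrite eq_complex /= !mul0r subr0 addr0 !eqxx.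
Qed.
End ExtendedTime.

(** * Hitting times and absorption *)

Section HittingTimes.
Context {disp : measure_display} {Omega : measurableType disp}.
Implicit Types (Z : nat -> Omega -> nat) (w : Omega) (d : nat).

Lemma hitting_timeP d Z w (o : option nat) :
  hitting_time d Z w = o <->
  if o is Some n then Z n w = d /\ forall s, (s < n)%N -> Z s w <> d
  else forall n, Z n w <> d.
Proof.
rewrite /hitting_time; case: pselect => [hits|nohit].
  case: ex_minnP => m /eqP Zm mmin; split=> [<-|].
    split=> // s sm Zs; move: sm; rewrite ltnNge mmin //; exact/eqP.
  case: o => [n [Zn nmin]|/(_ m) //]; congr Some; apply/eqP.
  rewrite eqn_leq mmin ?Zn ?eqxx // leqNgt; apply/negP => /nmin; exact.
split=> [<- n Zn|]; first by apply: nohit; exists n; exact/eqP.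
by case: o => [n [Zn _]|//]; case: nohit; exists n; exact/eqP.
Qed.

Lemma absorbed0 d Z w : absorbed d Z 0%N w = Z 0%N w.
Proof. by rewrite /absorbed; case: hitting_time => // s; rewrite min0n. Qed.

(** The recursion that makes [absorbed] a function of the path up to now. *)
Lemma absorbedS d Z n w : absorbed d Z n.+1 w =
  if absorbed d Z n w == d then d else Z n.+1 w.
Proof.
rewrite /absorbed; case E : hitting_time => [s|].
  have [Zs smin] := (hitting_timeP _ _ _ _).1 E.
  have [sn|ns] := leqP s n.
    by rewrite (minn_idPr (leqW sn)) Zs eqxx.
  rewrite (minn_idPl ns).
  by case: eqP => // /(smin _ ns).
by have := (hitting_timeP _ _ _ _).1 E n => /eqP /negbTE ->.
Qed.

Lemma absorbed_stays d Z m n w : (m <= n)%N ->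
  absorbed d Z m w = d -> absorbed d Z n w = d.
Proof.
move=> mn Zm; rewrite -(subnKC mn); elim: (n - m)%N => [|k IH].
  by rewrite addn0.
by rewrite addnS absorbedS IH eqxx.
Qed.

Lemma absorbed_before d Z n w :
  (forall s, (s < n)%N -> absorbed d Z s w <> d) -> absorbed d Z n w = Z n w.
Proof.
case: n => [|n] H; first exact: absorbed0.
by rewrite absorbedS; case: eqP => // /(H _ (ltnSn n)).
Qed.

Lemma absorbed_neq d Z n w :
  (forall s, (s < n)%N -> Z s w <> d) -> forall s, (s < n)%N -> absorbed d Z s w <> d.
Proof.
move=> H; elim/ltn_ind => s IH sn; rewrite absorbed_before; first exact: H.
by move=> t ts; apply: IH => //; exact: ltn_trans sn.
Qed.

Lemma hitting_time_absorbed d Z w :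
  hitting_time d (absorbed d Z) w = hitting_time d Z w.
Proof.
apply/hitting_timeP; case E : (hitting_time d Z w) => [n|].
  have [Zn H] := (hitting_timeP _ _ _ _).1 E.
  have H' := absorbed_neq _ _ _ _ H.
  by rewrite absorbed_before.
have H := (hitting_timeP _ _ _ _).1 E => n.
by apply: (@absorbed_neq d Z n.+1 w).
Qed.

Lemma hitting_time0 d Z w :
  hitting_time d Z w = Some 0%N <-> absorbed d Z 0%N w = d.
Proof.
rewrite absorbed0; split=> [/hitting_timeP [] //|Z0].
by apply/hitting_timeP.
Qed.

(** Since [d] is absorbing, two consecutive states decide whether [d] has just
    been hit. *)
Lemma hitting_timeS d Z n w : hitting_time d Z w = Some n.+1 <->
  absorbed d Z n.+1 w = d /\ absorbed d Z n w <> d.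
Proof.
rewrite -hitting_time_absorbed; split=> [/hitting_timeP [H1 H2]|[H1 H2]].
  by split=> //; apply: H2.
apply/hitting_timeP; split=> // s sn; apply: contra_not H2.
exact: absorbed_stays.
Qed.
End HittingTimes.

(** * Finite-dimensional laws of Markov chains *)

Section MarkovChains.
Context {disp : measure_display} {Omega : measurableType disp} {R : realType}.
Variable Pr : probability Omega R.
Implicit Types (q : nat -> nat -> R) (Z : nat -> Omega -> nat) (x : nat -> nat).

Definition past Z n x := [set w | forall s, (s <= n)%N -> Z s w = x s].

Lemma pastS Z n x :
  past Z n.+1 x = past Z n x `&` [set w | Z n.+1 w = x n.+1].
Proof.
apply/seteqP; split=> w /=; first by move=> H; split=> [s sn|]; apply: H => //; exact: leqW.
by move=> [H1 H2] s; rewrite leq_eqVlt => /predU1P[->//|]; exact: H1.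
Qed.

Lemma measurable_level (f : Omega -> nat) k :
  measurable_fun setT f -> measurable [set w | f w = k].
Proof. by move=> /(_ measurableT [set k]); rewrite setTI; apply. Qed.

Lemma measurable_past Z n x : (forall n, measurable_fun setT (Z n)) ->
  measurable (past Z n x).
Proof.
move=> mZ; elim: n => [|n IH]; last first.
  by rewrite pastS; apply: measurableI => //; exact: measurable_level.
have -> : past Z 0 x = [set w | Z 0%N w = x 0%N].
  by apply/seteqP; split=> w /=; [apply|move=> H s; rewrite leqn0 => /eqP ->].
exact: measurable_level.
Qed.

(** The Markov property without division, valid also for null pasts. *)
Lemma markov_step {q Z} : markov_chain Pr q Z -> forall n x j,
  fine (Pr (past Z n x `&` [set w | Z n.+1 w = j])) =
  fine (Pr (past Z n x)) * q (x n) j.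
Proof.
move=> [mZ H] n x j; have mp := measurable_past Z n x mZ.
have [p0|p0] := eqVneq (Pr (past Z n x)) 0%E.
  rewrite p0 mul0r; suff -> : Pr (past Z n x `&` [set w | Z n.+1 w = j]) = 0%E by [].
  apply/eqP; rewrite eq_le measure_ge0 andbT -p0; apply: le_measure.
  - by rewrite inE; apply: measurableI => //; exact: measurable_level.
  - by rewrite inE.
  - exact: subIsetl.
rewrite -(H n x j p0) mulrC divfK // fine_eq0 //.
exact: fin_num_measure.
Qed.

(** Confinement to [0..d] is only almost sure, hence the hypothesis on null
    events in place of a bound on [f]. *)
Lemma measure_split (B : set Omega) (f : Omega -> nat) (d : nat) :
  measurable B -> measurable_fun setT f ->
  (forall k, (d < k)%N -> fine (Pr (B `&` [set w | f w = k])) = 0) ->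
  fine (Pr B) = \sum_(k < d.+1) fine (Pr (B `&` [set w | f w = k])).
Proof.
move=> mB mf H.
have mBk k : measurable (B `&` [set w | f w = k]).
  by apply: measurableI => //; exact: measurable_level.
have BE : B = \bigcup_k (B `&` [set w | f w = k]).
  apply/seteqP; split=> [w Bw|w [k _ []//]]; by exists (f w).
rewrite {1}BE measure_semi_bigcup //; last by rewrite -BE.
  rewrite (nneseries_split 0%N d.+1) // eseries0 ?adde0 ?add0n.
    rewrite big_mkord -sum_fine // => k _; exact: fin_num_measure.
  move=> k dk _; apply/eqP; rewrite -fine_eq0 ?fin_num_measure //.
  by rewrite H.
apply/trivIsetP => i j _ _ ij; apply/seteqP; split=> // w [[_ /= fi] [_ /= fj]].
by move: ij; rewrite -fi -fj eqxx.
Qed.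

Definition closed_below q (d : nat) :=
  forall i j, (i <= d)%N -> (d < j)%N -> q i j = 0.

(** [n] further steps of a chain confined to [0..d] are governed by the
    [n]-th power of the matrix of its kernel. *)
Lemma markov_power {q Z} {d : nat} (A : 'M[R]_d.+1) :
  markov_chain Pr q Z -> closed_below q d -> (forall i j, A i j = q i j) ->
  forall n m x (i j : 'I_d.+1), x m = i ->
  fine (Pr (past Z m x `&` [set w | Z (m + n)%N w = j])) =
  fine (Pr (past Z m x)) * (A ^+ n) i j.
Proof.
move=> mc cl AE; have mZ := mc.1.
elim=> [|n IH] m x i j xm.
  rewrite addn0 expr0 mxE; case: eqP => [<-|/eqP ij].
    rewrite mulr1; congr (fine (Pr _)); apply: setIidl => w pw /=.
    by rewrite -xm; apply: pw.
  rewrite mulr0; suff -> : past Z m x `&` [set w | Z m w = j] = set0 by rewrite measure0.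
  apply/seteqP; split=> // w [/(_ m (leqnn m)) + /= Zj].
  by rewrite Zj xm => /esym/ord_inj/eqP; rewrite (negbTE ij).
have mp := measurable_past Z m x mZ.
set B := past Z m x `&` _.
have mB : measurable B by apply: measurableI => //; exact: measurable_level.
have Bk k : B `&` [set w | Z m.+1 w = k] =
    past Z m.+1 (fun s => if (s <= m)%N then x s else k) `&`
    [set w | Z (m.+1 + n)%N w = j].
  rewrite pastS ltnn /B addSnnS setIAC; congr (_ `&` _ `&` _).
  by apply/seteqP; split=> w pw s sm; have := pw s sm; rewrite sm.
have pE k : past Z m.+1 (fun s => if (s <= m)%N then x s else k) =
    past Z m x `&` [set w | Z m.+1 w = k].
  rewrite pastS ltnn; congr (_ `&` _).
  by apply/seteqP; split=> w pw s sm; have := pw s sm; rewrite sm.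
(* Condition on the next state [k], which extends the past by one step. *)
rewrite (measure_split _ _ d mB (mZ m.+1)).
  rewrite exprS -[A * _]/(A *m _) mxE mulr_sumr; apply: eq_bigr => k _.
  rewrite Bk (IH _ _ k) ?ltnn // pE (markov_step mc) AE xm mulrA //.
move=> k dk; have : fine (Pr (past Z m x `&` [set w | Z m.+1 w = k])) = 0.
  by rewrite (markov_step mc) xm cl ?mulr0 // -ltnS.
move=> /eqP; rewrite fine_eq0 ?fin_num_measure //; last first.
  by apply: measurableI => //; exact: measurable_level.
move=> /eqP p0; suff -> : Pr (B `&` [set w | Z m.+1 w = k]) = 0%E by [].
apply/eqP; rewrite eq_le measure_ge0 andbT -p0; apply: le_measure; rewrite ?inE.
- by apply: measurableI => //; exact: measurable_level.
- by apply: measurableI => //; exact: measurable_level.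
- by apply: setSI; exact: subIsetl.
Qed.

Lemma measurable_absorbed d Z : (forall n, measurable_fun setT (Z n)) ->
  forall n, measurable_fun setT (absorbed d Z n).
Proof.
move=> mZ; elim=> [|n IH].
  by have -> : absorbed d Z 0 = Z 0%N by apply/funext => w; rewrite absorbed0.
have -> : absorbed d Z n.+1 = fun w => if absorbed d Z n w == d then d else Z n.+1 w.
  by apply/funext => w; rewrite absorbedS.
move=> _ B _; rewrite setTI.
have -> : (fun w => if absorbed d Z n w == d then d else Z n.+1 w) @^-1` B =
    ([set w | absorbed d Z n w = d] `&` [set w | B d]) `|`
    (~` [set w | absorbed d Z n w = d] `&` Z n.+1 @^-1` B).
  apply/seteqP; split=> w /=; case: eqP => [e|ne] //; try by [left|right].
    by case=> -[].
  by case=> -[].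
apply: measurableU; apply: measurableI.
- exact: measurable_level.
- by have [Bd|nBd] := pselect (B d);
    [rewrite (_ : [set _ | _] = setT) //|rewrite (_ : [set _ | _] = set0) //];
    apply/seteqP; split.
- by apply: measurableC; exact: measurable_level.
- by rewrite -[X in measurable X]setTI; exact: mZ.
Qed.

(** Before [d] is hit, a past of the absorbed process is a past of [Z];
    afterwards the absorbed process no longer moves. *)
Lemma markov_absorbed p Z d : markov_chain Pr p Z ->
  markov_chain Pr (absorbing_kernel d p) (absorbed d Z).
Proof.
move=> mc; have mZ := mc.1; have mX := measurable_absorbed d _ mZ.
split=> // n x j; rewrite -/(past (absorbed d Z) n x) => P next P0.
have fP0 : fine (Pr P) != 0.
  by rewrite fine_eq0 // fin_num_measure //; exact: measurable_past.
rewrite /absorbing_kernel /next; have [xd|/eqP xnd] := eqVneq (x n) d.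
  have Pd w : P w -> absorbed d Z n.+1 w = d.
    move=> /(_ n (leqnn n)) Xn; apply: (@absorbed_stays _ _ d Z n) => //.
    by rewrite Xn.
  have [->|jd] := eqVneq j d.
    suff -> : P `&` [set w | absorbed d Z n.+1 w = d] = P by rewrite divff.
    by apply: setIidl => w /Pd.
  suff -> : P `&` [set w | absorbed d Z n.+1 w = j] = set0 by rewrite measure0 mul0r.
  by apply/seteqP; split=> // w [/Pd + /= Xj]; rewrite Xj => /eqP; rewrite (negbTE jd).
have [w0 Pw0] : exists w, P w.
  apply/set0P; apply: contraNN P0 => /eqP ->; by rewrite measure0.
have xs s : (s <= n)%N -> x s <> d.
  move=> sn xsd; apply: xnd; rewrite -(Pw0 n (leqnn n)).
  by apply: (@absorbed_stays _ _ d Z s) => //; rewrite (Pw0 s sn).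
have PE : P = past Z n x.
  apply/seteqP; split=> w Pw s sn; have := Pw s sn.
    rewrite absorbed_before // => t ts.
    have tn : (t <= n)%N by apply: ltnW; exact: leq_trans sn.
    by rewrite (Pw t tn); exact: xs.
  move=> <-; rewrite absorbed_before //.
  apply: absorbed_neq => t ts.
  have tn : (t <= n)%N by apply: ltnW; exact: leq_trans sn.
  by rewrite (Pw t tn); exact: xs.
have -> : P `&` [set w | absorbed d Z n.+1 w = j] = past Z n x `&` [set w | Z n.+1 w = j].
  rewrite PE; apply/seteqP; split=> w [pw nw]; split=> //; move: nw;
    rewrite /= absorbedS; have := pw; rewrite -PE => /(_ n (leqnn n)) ->;
    by case: eqP.
by rewrite (markov_step mc) -PE mulrAC divff ?mul1r.
Qed.

Lemma measurable_hitting_time d Z k : (forall n, measurable_fun setT (Z n)) ->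
  measurable [set w | hitting_time d Z w = Some k].
Proof.
move=> mZ; have mX := measurable_absorbed d _ mZ.
case: k => [|k].
  rewrite (_ : [set _ | _] = [set w | absorbed d Z 0%N w = d]); first exact: measurable_level.
  by apply/seteqP; split=> w /= /hitting_time0.
rewrite (_ : [set _ | _] = [set w | absorbed d Z k.+1 w = d] `\`
   [set w | absorbed d Z k w = d]).
  by apply: measurableD; exact: measurable_level.
by apply/seteqP; split=> w /= /hitting_timeS.
Qed.

Lemma prob_hitting_time d Z : (forall n, measurable_fun setT (Z n)) ->
  (fun k => fine (Pr [set w | hitting_time d Z w = Some k])) =1
  shift_diff 1 (fun k => fine (Pr [set w | absorbed d Z k w = d])).
Proof.
move=> mZ; have mX := measurable_absorbed d _ mZ; case=> [|k].
  rewrite /shift_diff mulr0 subr0; congr (fine (Pr _)).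
  by apply/seteqP; split=> w /= /hitting_time0.
rewrite /shift_diff mul1r -fineB ?fin_num_measure //; try exact: measurable_level.
have <- : [set w | absorbed d Z k.+1 w = d] `&` [set w | absorbed d Z k w = d] =
    [set w | absorbed d Z k w = d].
  by apply: setIidr => w /=; exact: absorbed_stays.
rewrite -measureD; try exact: measurable_level.
  by congr (fine (Pr _)); apply/seteqP; split=> w /= /hitting_timeS.
by rewrite ltey_eq fin_num_measure //; exact: measurable_level.
Qed.

End MarkovChains.

(** * Skip-free kernels *)

Section Kernels.
Context {R : realType}.
Implicit Types p : nat -> nat -> R.

(** If [p i i.+1] were 0, the states up to [i] would be closed under [p]. *)
Lemma skip_free_irreducible p : skip_free p -> irreducible p ->
  forall i, p i i.+1 != 0.
Proof.
move=> sf irr i; apply/eqP => pi0.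
suff H n : forall k j, (k <= i)%N -> (i < j)%N -> nstep p n k j = 0%E.
  by have [n] := irr i i.+1; rewrite H // ltxx.
elim: n => [k j ki ij /=|n IH k j ki ij /=].
  by rewrite (ltn_eqF (leq_ltn_trans ki ij)).
apply: eseries0 => l _ _; have [li|il] := leqP l i; first by rewrite IH ?mule0.
have -> : p k l = 0; last by rewrite mul0e.
have [lk|kil] := eqVneq l k.+1.
  suff ki' : k = i by rewrite lk ki'.
  by apply/eqP; rewrite eqn_leq ki -ltnS -lk.
by apply: sf; rewrite ltn_neqAle eq_sym kil (leq_ltn_trans ki il).
Qed.

Lemma stochastic_row_sum p (d i : nat) : stochastic p -> skip_free p ->
  (i < d)%N -> \sum_(j < d.+1) p i j = 1.
Proof.
move=> [p0 p1] sf id; have := p1 i.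
rewrite (nneseries_split 0%N d.+1) => [|k _]; last by rewrite lee_fin.
rewrite eseries0 ?adde0 ?add0n => [|k dk _].
  by rewrite big_mkord sumEFin => -[].
by rewrite sf // (leq_trans _ dk).
Qed.
End Kernels.

(** * The hitting time of a skip-free chain *)

Section Main.
Context {disp : measure_display} {Omega : measurableType disp} {R : realType}.
Variables (Pr : probability Omega R) (p : nat -> nat -> R).
Variables (Y : nat -> Omega -> nat) (d : nat).
Hypotheses (p_stochastic : stochastic p) (p_skip_free : skip_free p).

Let P := absorbing_matrix d p.
Let A := map_mx (real_complex R) P.
Let X := absorbed d Y.
Let T := hitting_time d Y.
Let superdiag := \prod_(i < d) A (inord i) (inord i.+1).
Let f k := fine (Pr [set w | T w = Some k]).

Let AE i j : A i j = (absorbing_kernel d p i j)%:C%C.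
Proof. by rewrite !mxE. Qed.

Lemma absorbing_matrix_hessenberg : hessenberg A.
Proof.
move=> i j ij; rewrite AE /absorbing_kernel ltn_eqF; first by rewrite p_skip_free.
by rewrite -ltnS (leq_trans ij) // ltnW.
Qed.

Lemma absorbing_matrix_last : row ord_max A = delta_mx 0 ord_max.
Proof.
apply/rowP => j; rewrite mxE AE mxE /absorbing_kernel /= eqxx -val_eqE /=.
by case: eqP.
Qed.

Lemma absorbing_matrix_ones : A *m const_mx 1 = const_mx 1 :> 'cV_d.+1.
Proof.
apply/colP => i; rewrite !mxE.
under eq_bigr => j _ do rewrite AE mxE mulr1.
rewrite -rmorph_sum /absorbing_kernel; have [id|id] := eqVneq (i : nat) d.
  rewrite (bigD1 ord_max) //= eqxx big1 ?addr0 // => j.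
  by rewrite -val_eqE /= => /negbTE ->.
rewrite (stochastic_row_sum _ _ _ p_stochastic p_skip_free) //.
by rewrite ltn_neqAle id -ltnS ltn_ord.
Qed.

Hypothesis p_irreducible : irreducible p.

Lemma absorbing_matrix_superdiag : superdiag != 0.
Proof.
apply/prodf_neq0 => i _; rewrite AE /absorbing_kernel.
rewrite (inordK (leqW (ltn_ord i))) (@inordK d i.+1) ?ltnS //.
by rewrite ltn_eqF // fmorph_eq0; exact: skip_free_irreducible.
Qed.

Hypotheses (Y_markov : markov_chain Pr p Y).
Hypothesis Y_start : Pr [set w | Y 0%N w = 0%N] = 1%E.

(** The starting point [Y 0 = 0] holds with probability one, so the event
    [Y 0 = 0] may be intersected with any other. *)
Lemma absorbed_at_target n :
  fine (Pr [set w | X n w = d]) = (P ^+ n) ord0 ord_max.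
Proof.
have mX := (markov_absorbed _ _ _ d Y_markov).1.
have cl : closed_below (absorbing_kernel d p) d.
  move=> i j id dj; rewrite /absorbing_kernel; case: eqP => [_|/eqP ne].
    by rewrite gtn_eqF.
  by rewrite p_skip_free // (leq_ltn_trans _ dj) // ltn_neqAle ne.
have PE i j : P i j = absorbing_kernel d p i j by rewrite mxE.
have := markov_power _ P (markov_absorbed _ _ _ d Y_markov) cl PE n 0%N
  (fun=> 0%N) ord0 ord_max erefl.
set E := past _ _ _; have E1 : Pr E = 1%E.
  rewrite -Y_start; congr (Pr _); apply/seteqP; split=> w /=.
    by move=> /(_ 0%N isT); rewrite absorbed0.
  by move=> Y0 s; rewrite leqn0 => /eqP ->; rewrite absorbed0.
have mE : measurable E by exact: measurable_past.
have mB : measurable [set w | X n w = d] by exact: measurable_level.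
rewrite E1 mul1r => <-; congr fine.
rewrite (measureDI Pr mB mE) setIC.
suff D0 : Pr ([set w | X n w = d] `\` E) = 0%E by rewrite [X in (X + _)%E]D0 add0e.
apply/eqP; rewrite eq_le measure_ge0 andbT.
have : Pr (~` E) = 0%E by rewrite probability_setC // E1 subee.
move=> <-; apply: le_measure; rewrite ?inE.
- exact: measurableD.
- exact: measurableC.
- by move=> w [].
Qed.

Let mT k : measurable [set w | T w = Some k].
Proof. exact: measurable_hitting_time Y_markov.1. Qed.

(** The eigenvalue 1 is the one consumed in passing from [Pr (T <= k)] to
    [Pr (T = k)]. *)
Lemma hitting_pmf_recurrence (theta : seq R[i]) :
  size theta = d ->
  char_poly A = \prod_(z <- rcons theta 1) ('X - z%:P) ->
  foldr shift_diff (fun k => (f k)%:C%C) theta =1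
  fun n => if n == d then superdiag else 0.
Proof.
move=> st At n.
rewrite -(absorbing_recurrence _ absorbing_matrix_hessenberg _ At st) foldr_rcons.
congr (foldr shift_diff _ theta n); apply/funext => k; rewrite /f.
rewrite prob_hitting_time; last exact: Y_markov.1.
transitivity (foldr shift_diff
   (fun m => (fine (Pr [set w | X m w = d]))%:C%C) [:: (1%R)%:C%C] k).
  by rewrite (foldr_shift_diff_rmorph _ _ [:: 1]).
rewrite /= rmorph1; apply: eq_shift_diff => m.
by rewrite absorbed_at_target /A -rmorphXn /= mxE.
Qed.

Lemma hitting_pgf (theta : seq R[i]) (u : R[i]) :
  size theta = d ->
  char_poly A = \prod_(z <- rcons theta 1) ('X - z%:P) -> `|u| <= 1 ->
  (\prod_(z <- theta) (1 - z * u)) * pgf Pr T u = superdiag * u ^+ d.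
Proof.
move=> st At u1.
by apply: series_limit_eq (cvg_series_pgf _ _ mT _ u1) _; exact: hitting_pmf_recurrence.
Qed.

(** At [u = 1] the convention [u ^ oo = 0] makes the expectation [Pr (T < oo)]. *)
Lemma hitting_time_finite :
  pgf Pr T 1 = 1 -> Pr [set w | T w = None] = 0%E.
Proof.
move=> pgf1; set N := [set w | _].
have mN : measurable N.
  rewrite (_ : N = ~` \bigcup_k [set w | T w = Some k]).
    by apply: measurableC; apply: bigcupT_measurable; exact: mT.
  apply/seteqP; split=> w; rewrite /N /=; first by move=> TN [k _ /=]; rewrite TN.
  by case E : (T w) => [k|] // []; exists k.
have := congr1 (@complex.Re R) pgf1; rewrite /pgf /cexpectation /=.
have -> : (fun w => complex.Re (match T w with Some n => 1 ^+ n | None => 0 end : R[i])) =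
    \1_(~` N) :> (Omega -> R).
  apply/funext => w; rewrite indicE; case E : (T w) => [k|].
    by rewrite expr1n mem_set //= /N /= E.
  by rewrite memNset //= /N /= E.
rewrite expectation_indic; last exact: measurableC.
rewrite probability_setC // fineB ?fin_num_measure //= => /eqP.
rewrite -subr_eq0 addrAC subrr add0r oppr_eq0 fine_eq0 ?fin_num_measure //.
by move/eqP.
Qed.
End Main.


Theorem theorem1p2 (R : realType) (disp : measure_display)
    (Omega : measurableType disp) (Pr : probability Omega R)
    (p : nat -> nat -> R) (Y : nat -> Omega -> nat) (d : nat)
    (p_stochastic : stochastic p) (p_skip_free : skip_free p)
    (p_irreducible : irreducible p)
    (Y_markov : markov_chain Pr p Y)
    (Y_start : Pr [set w | Y 0%N w = 0%N] = 1%E)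
    (eigenvalues : seq R[i])
    (eigenvaluesP : spectrum (absorbing_matrix d p) eigenvalues) :
  let X := absorbed d Y in
  let T := hitting_time d Y in
  let theta := [seq z <- eigenvalues | z != 1] in
  [/\ markov_chain Pr (absorbing_kernel d p) X,
      forall w, hitting_time d X w = T w,
      size theta = d,
      forall u : R[i], `|u| < 1 ->
        pgf Pr T u =
        \prod_(j < d) ((1 - theta`_j) * u / (1 - theta`_j * u))
    & (* in R[i], 0 <= z means that z is real and nonnegative *)
      (forall j : 'I_d, 0 <= theta`_j) ->
      has_distribution Pr T
        (\big[convolution/dirac0_pmf]_(j < d)
            geometric_pmf (1 - complex.Re theta`_j))].
Proof.
move=> X T theta.
have hA := absorbing_matrix_hessenberg p d p_skip_free.
have A0 := absorbing_matrix_superdiag p d p_skip_free p_irreducible.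
have [st cE At] := absorbing_char_poly _ hA A0 (absorbing_matrix_last p d)
  (absorbing_matrix_ones p d p_stochastic p_skip_free) _ eigenvaluesP.
rewrite -/theta in st cE At.
have pgfE u : `|u| <= 1 ->
    (\prod_(z <- theta) (1 - z * u)) * pgf Pr T u = \prod_(z <- theta) (1 - z) * u ^+ d.
  by rewrite cE; exact: hitting_pgf.
have c0 : \prod_(z <- theta) (1 - z) != 0 by rewrite cE.
split=> // [||u u1|theta0].
- exact: markov_absorbed.
- by move=> w; exact: hitting_time_absorbed.
(* The identity [pgfE] itself shows that no [1 - theta u] vanishes. *)
- have D0 : \prod_(z <- theta) (1 - z * u) != 0.
    have [->|u0] := eqVneq u 0.
      by rewrite big1 ?oner_neq0 // => z _; rewrite mulr0 subr0.
    have : \prod_(z <- theta) (1 - z) * u ^+ d != 0 by rewrite mulf_neq0 ?expf_neq0.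
    by rewrite -pgfE ?ltW // mulf_eq0 negb_or => /andP[].
  apply: (mulfI D0); rewrite pgfE ?ltW //.
  rewrite prodf_div big_split prodr_const card_ord /=.
  have big_theta (F : R[i] -> R[i]) : \prod_(j < d) F theta`_j = \prod_(z <- theta) F z.
    by rewrite (big_nth 0) st big_mkord.
  by rewrite (big_theta (fun z => 1 - z)) (big_theta (fun z => 1 - z * u)) [RHS]mulrC divfK.
- split.
    apply: hitting_time_finite => //.
      exact: Y_markov.
    apply: (mulfI c0).
    transitivity (\prod_(z <- theta) (1 - z) * 1 ^+ d); last by rewrite expr1n.
    by rewrite -pgfE ?normr1 //; congr (_ * _); apply: eq_bigr => z _; rewrite mulr1.
  move=> k; rewrite -[LHS]fineK ?fin_num_measure //;
    last exact: measurable_hitting_time Y_markov.1.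
  congr EFin.
  pose t := [seq complex.Re z | z <- theta].
  have tE : theta = [seq z%:C%C | z <- t].
    rewrite -map_comp -[LHS]map_id; apply/eq_in_map => z /(nthP 0)[j].
    rewrite st => jd <-; have := theta0 (Ordinal jd).
    by rewrite lecE /= => /andP[/eqP + _]; case: (theta`_j) => a b /= ->.
  have -> : \big[convolution/dirac0_pmf]_(j < d) geometric_pmf (1 - complex.Re theta`_j) =
      foldr (fun z => convolution (geometric_pmf (1 - z))) dirac0_pmf t.
    by rewrite -big_foldr big_map (big_nth 0) st big_mkord.
  move: k; apply: (foldr_shift_diff_inj t) => n.
  rewrite foldr_shift_diff_geometric; apply: (fmorph_inj (real_complex R)).
  rewrite -foldr_shift_diff_rmorph -/t -tE.
  rewrite (hitting_pmf_recurrence _ _ _ _ p_skip_free Y_markov Y_start _ st At).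
  rewrite size_map st; case: eqP => _; last by rewrite rmorph0.
  by rewrite -cE tE rmorph_prod !big_map; apply: eq_bigr => z _; rewrite rmorphB rmorph1.
Qed.
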